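(* Let $(M,g)$ be a Riemannian $n$-manifold with $n\geq 4$ and let $k=\frac{2n(n-1)}{3n-4}$. Then $$\Gamma_2(A)>0\iff \Gamma_2(\mathrm{Ein}_k)>0.$$
   Context: $\mathrm{Ein}_k:=\mathrm{Scal}\cdot g-k\,\mathrm{Ric}$, with $\mathrm{Ric}$ and $\mathrm{Scal}$ the Ricci tensor and scalar curvature of $g$. The Schouten tensor is $A=\frac{1}{n-2}\left(\mathrm{Ric}-\frac{\mathrm{Scal}}{2(n-1)}g\right)$. For a symmetric $2$-tensor $T$, $\sigma_i(T)$ denotes the $i$-th elementary symmetric function of the eigenvalues of $T$ with respect to $g$, and $\Gamma_2(T)>0$ means $\sigma_1(T)>0$ and $\sigma_2(T)>0$ (at each point). *)

(* Defs.v *)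
From HB Require Import structures.
From mathcomp Require Import all_boot all_order all_algebra.
From mathcomp Require Import all_classical all_reals topology normedtype derive.

Set Implicit Arguments.
Unset Strict Implicit.
Unset Printing Implicit Defensive.

Import Order.TTheory GRing.Theory Num.Theory.
Import numFieldNormedType.Exports.

Local Open Scope classical_set_scope.
Local Open Scope ring_scope.

Section SmoothFunctions.
Context {R : realType} {n : nat}.
Implicit Types (U : set 'rV[R]_n) (f : 'rV[R]_n -> R).

Definition partial (i : 'I_n) f : 'rV[R]_n -> R :=
  fun x => 'D_(delta_mx 0 i) (f : 'rV[R]_n -> R^o) x.

Definition partially_derivable f (x : 'rV[R]_n) (i : 'I_n) : Prop :=
  derivable (f : 'rV[R]_n -> R^o) x (delta_mx 0 i).

(* Only used for U open, where existence and continuity on U of all iterated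
   partial derivatives of order at most k characterises class C^k. *)
Fixpoint Ck_on (k : nat) U f : Prop :=
  (forall x, U x -> {for x, continuous f}) /\
  if k is k'.+1 then
    forall i, (forall x, U x -> partially_derivable f x i) /\
              Ck_on k' U (partial i f)
  else True.

Definition smooth_on U f : Prop := forall k, Ck_on k U f.

End SmoothFunctions.

Section Manifolds.
Variables (R : realType) (n : nat).

(* A homeomorphism from an open subset of M onto an open subset of R^n; both
   maps are total functions, with irrelevant values outside these subsets. *)
Record chart (M : topologicalType) := Chart {
  chart_dom : set M;
  chart_map :> M -> 'rV[R]_n;
  chart_inv : 'rV[R]_n -> M;
  chart_dom_open : open chart_dom;
  chart_cod_open : open (chart_map @` chart_dom);
  chart_mapK : {in chart_dom, cancel chart_map chart_inv};
  chart_map_continuous : {within chart_dom, continuous chart_map};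
  chart_inv_continuous : {within chart_map @` chart_dom, continuous chart_inv}
}.

Definition chart_cod (M : topologicalType) (c : chart M) : set 'rV[R]_n :=
  c @` chart_dom c.

Definition transition (M : topologicalType) (c d : chart M) :
  'rV[R]_n -> 'rV[R]_n := d \o chart_inv c.

Record smooth_manifold := SmoothManifold {
  carrier :> topologicalType;
  manifold_hausdorff : hausdorff_space carrier;
  manifold_second_countable : @second_countable carrier;
  atlas : set (chart carrier);
  atlas_cover : forall p, exists2 c, atlas c & chart_dom c p;
  atlas_smooth : forall c d, atlas c -> atlas d -> forall i : 'I_n,
    smooth_on (c @` (chart_dom c `&` chart_dom d))
              (fun x => transition c d x 0 i)
}.

(* A field of covariant 2-tensors is given by its matrix of components in the
   coordinates of each chart.  Only the values at charts c of the atlas and at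
   points of chart_cod c are relevant. *)
Definition tensor2 (M : smooth_manifold) := chart M -> 'rV[R]_n -> 'M[R]_n.

Record riemannian_metric (M : smooth_manifold) := RiemannianMetric {
  metric :> chart M -> 'rV[R]_n -> 'M[R]_n;
  metric_smooth : forall c, atlas c -> forall i j,
    smooth_on (chart_cod c) (fun x => metric c x i j);
  metric_symmetric : forall c, atlas c -> forall x, chart_cod c x ->
    (metric c x)^T = metric c x;
  metric_posdef : forall c, atlas c -> forall x, chart_cod c x ->
    forall v : 'rV[R]_n, v != 0 -> 0 < (v *m metric c x *m v^T) 0 0;
  (* Tangent vectors are row vectors: u in the chart c becomes u *m J in d. *)
  metric_transition : forall c d, atlas c -> atlas d ->
    forall p, (chart_dom c `&` chart_dom d) p ->
    let J := 'J (transition c d) (c p) in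
    metric c (c p) = J *m metric d (d p) *m J^T
}.

End Manifolds.

Section LocalCurvature.
Context {R : realType} {n : nat}.
Variable g : 'rV[R]_n -> 'M[R]_n.
Implicit Types (i j k l m : 'I_n) (x : 'rV[R]_n).

(* Gamma^k_ij *)
Definition christoffel k i j x : R :=
  2^-1 * \sum_l invmx (g x) k l *
    (partial i (fun y => g y j l) x + partial j (fun y => g y i l) x
     - partial l (fun y => g y i j) x).

(* The d_l-component of R(d_i, d_j) d_k, for the sign convention
   R(X, Y) Z = nabla_X nabla_Y Z - nabla_Y nabla_X Z - nabla_[X, Y] Z. *)
Definition riemann l i j k x : R :=
  partial i (christoffel l j k) x - partial j (christoffel l i k) x
  + \sum_m (christoffel m j k x * christoffel l i m x
            - christoffel m i k x * christoffel l j m x).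

(* Ric(Y, Z) is the trace of X |-> R(X, Y) Z. *)
Definition ricci_local x : 'M[R]_n := \matrix_(j, k) \sum_i riemann i i j k x.

Definition scalar_local x : R :=
  \sum_i \sum_j invmx (g x) i j * ricci_local x i j.

End LocalCurvature.

Section Tensors.
Context {R : realType} {n : nat} {M : smooth_manifold R n}.
Implicit Types (g : riemannian_metric M) (T : tensor2 M).

Definition Ric g : tensor2 M := fun c x => ricci_local (g c) x.

(* Coordinate expression of the scalar curvature. *)
Definition Scal g (c : chart R n M) (x : 'rV[R]_n) : R := scalar_local (g c) x.

Definition Schouten g : tensor2 M := fun c x =>
  (n%:R - 2)^-1 *: (Ric g c x - (Scal g c x / (2 * (n%:R - 1))) *: g c x).

Definition Ein g (k : R) : tensor2 M := fun c x =>
  Scal g c x *: g c x - k *: Ric g c x.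

End Tensors.

Section ElementarySymmetric.
Context {R : realType} {n : nat}.
Implicit Types G T : 'M[R]_n.

(* The eigenvalues of the bilinear form T with respect to the inner product G
   are those of the endomorphism u |-> u *m (T *m invmx G) corresponding to T,
   listed with multiplicity. They are real when T is symmetric; if the
   characteristic polynomial does not split over R the value is the zero
   tuple. *)
Definition eigenvalues G T : n.-tuple R :=
  xget [tuple of nseq n 0]
    [set s : n.-tuple R |
      char_poly (T *m invmx G) = \prod_(a <- s) ('X - a%:P)].

Definition elem_sym (i : nat) (s : n.-tuple R) : R :=
  \sum_(I : {set 'I_n} | #|I| == i) \prod_(j in I) tnth s j.

Definition sigma (i : nat) G T : R := elem_sym i (eigenvalues G T).

End ElementarySymmetric.

(* The values of sigma at a point do not depend on the chart around it. *)
Definition Gamma2_pos (R : realType) (n : nat) (M : smooth_manifold R n)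
    (g : riemannian_metric M) (T : tensor2 M) : Prop :=
  forall (p : M) (c : chart R n M), atlas c -> chart_dom c p ->
    0 < sigma 1 (g c (c p)) (T c (c p)) /\
    0 < sigma 2 (g c (c p)) (T c (c p)).

(* Main.v *)
(** The tensors [A] and [Ein_k] are both of the form [a Ric + b g] with [a <> 0],
    so their eigenvalues are affine images of those of [Ric].  If [s] is the sum
    of the eigenvalues of [Ric] and [q] the sum of their squares, then
    [sigma_1(A) = s / (2(n-1))] and [sigma_1(Ein_k) = (n-k) s], while for the
    given [k] both [2 (n-2)^2 sigma_2(A)] and [2 sigma_2(Ein_k) / k^2] equal
    [n s^2 / (4(n-1)) - q].  The symmetry of [Ric] is never
    used: where its characteristic polynomial does not split, neither do those
    of [A] and [Ein_k], so [eigenvalues] takes its junk value zero for both and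
    neither side of the equivalence holds. *)
Require Import Defs.
From mathcomp Require Import all_boot all_order all_algebra.
From mathcomp Require Import all_classical all_reals.
From mathcomp Require Import ring lra.

Import Order.TTheory GRing.Theory Num.Theory.

Local Open Scope ring_scope.

(** Over polynomials, ['X - (a X + b) = a (q - X)] with [q = ('X - b) / a], so the determinant is
    [a ^+ n] times the characteristic polynomial of [X] composed with [q]. No triangular form is
    needed. *)
Lemma char_poly_affine (F : fieldType) (n : nat) (X : 'M[F]_n) (a b : F)
    (s : seq F) : a != 0 -> size s = n ->
  char_poly X = \prod_(x <- s) ('X - x%:P) ->
  char_poly (a *: X + b%:M) =
    \prod_(y <- [seq a * x + b | x <- s]) ('X - y%:P).
Proof.
move=> a0 sz splitX; pose q : {poly F} := a^-1 *: ('X - b%:P).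
have aq : a%:P * q = 'X - b%:P.
  by rewrite mul_polyC scalerA mulfV // scale1r.
have -> : char_poly (a *: X + b%:M) = a%:P ^+ n * (char_poly X \Po q).
  rewrite /char_poly -det_map_mx -detZ; congr (\det _).
  apply/matrixP=> i j; rewrite !mxE.
  rewrite rmorphB rmorphMn /= comp_polyX comp_polyC mulrBr mulrnAr aq.
  by rewrite polyCD polyCM polyCMn mulrnBl opprD addrA addrAC.
(* With [n] turned into a list length, induction gives each linear factor one copy of [a]. *)
rewrite splitX big_map rmorph_prod -sz -(size_map (fun x => q - x%:P)).
elim: s {sz splitX} => [|x s IH]; first by rewrite !big_nil mulr1.
rewrite !big_cons -IH /= exprS mulrACA; congr (_ * _).
rewrite comp_polyB comp_polyX comp_polyC mulrBr aq rmorphD rmorphM.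
by rewrite opprD addrA addrAC.
Qed.

Lemma trace_split (F : fieldType) (n : nat) (X : 'M[F]_n) (s : seq F) :
  (0 < n)%N -> size s = n -> char_poly X = \prod_(x <- s) ('X - x%:P) ->
  \tr X = \sum_(x <- s) x.
Proof.
move=> n0 sz splitX; apply: oppr_inj.
by rewrite -char_poly_trace // splitX -sz coefPn_prod_XsubC // sz -lt0n.
Qed.

Section Eigenvalues.
Context {R : realType} {n : nat}.
Implicit Types (G T X : 'M[R]_n) (s : n.-tuple R).

(** The chosen tuple is pinned down only up to order, by unique factorization into monic linear
    factors. *)
Lemma eigenvalues_split G T s :
  char_poly (T *m invmx G) = \prod_(x <- s) ('X - x%:P) ->
  perm_eq (eigenvalues G T) s.
Proof.
move=> Ps; apply: prod_XsubC_eq; rewrite -Ps.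
by rewrite /eigenvalues; case: xgetP => [t _ -> //|/(_ s)].
Qed.

Lemma elem_sym1 s : elem_sym 1 s = \sum_(x <- s) x.
Proof.
rewrite big_tuple /elem_sym.
rewrite (eq_bigl (fun I => I \in @finset.set1 _ @: [set: 'I_n])) => [|I];
  last by apply/cards1P/imsetP => [[i ->]|[i _ ->]]; exists i.
rewrite big_imset => [|i j _ _ /set1_inj //].
by apply: eq_big => i; rewrite ?inE //= big_set1.
Qed.

(** The square expands over ordered pairs: the diagonal gives the sum of squares, and each
    two-element set arises from exactly two off-diagonal pairs. *)
Lemma elem_sym2 s :
  2 * elem_sym 2 s = (\sum_(x <- s) x) ^+ 2 - \sum_(x <- s) x ^+ 2.
Proof.
pose f := tnth s; rewrite !big_tuple -/f.
have -> : (\sum_i f i) ^+ 2 =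
    \sum_(p : 'I_n * 'I_n | p.1 != p.2) f p.1 * f p.2 + \sum_i f i ^+ 2.
  rewrite expr2 mulr_suml; under eq_bigr do rewrite mulr_sumr.
  rewrite pair_bigA /= (bigID (fun p => p.1 != p.2)) /=; congr (_ + _).
  under eq_bigl do rewrite negbK.
  rewrite -(pair_big_dep xpredT (fun i j => i == j) (fun i j => f i * f j)) /=.
  by apply: eq_bigr => i _; rewrite (eq_bigl (pred1 i)) ?big_pred1_eq // => j;
    rewrite /= eq_sym.
rewrite addrK /elem_sym mulr_sumr.
rewrite (partition_big (fun p => [set p.1; p.2]) (fun I => #|I| == 2)) /=;
  last by move=> p pN; rewrite cards2 pN.
apply: eq_bigr => I /cards2P [x [y [xy ->]]].
rewrite (bigD1 (x, y)) /=; last by rewrite xy eqxx.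
rewrite (bigD1 (y, x)) /=; last first.
  by rewrite eq_sym xy finset.setUC eqxx xpair_eqE negb_and eq_sym xy.
rewrite [X in _ = _ + (_ + X)]big1.
  by rewrite big_setU1 ?inE //= big_set1 -/f addr0
    [f y * _]mulrC mulr2n mulrDl mul1r.
(* No third ordered pair of distinct indices has underlying set [[set x; y]]. *)
move=> [i j] /= /andP[/andP[/andP[ij /eqP E] N1] N2].
have := finset.set21 i j; rewrite E !inE => hi.
have := finset.set22 i j; rewrite E !inE => hj.
move: N1 N2 ij; rewrite !xpair_eqE.
by case/orP: hi => /eqP ->; case/orP: hj => /eqP ->; rewrite !eqxx.
Qed.

Lemma sigma_affine G X s (a b : R) : G \in unitmx -> a != 0 ->
  char_poly (X *m invmx G) = \prod_(x <- s) ('X - x%:P) ->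
  let S := \sum_(x <- s) x in let Q := \sum_(x <- s) x ^+ 2 in
  sigma 1 G (a *: X + b *: G) = a * S + n%:R * b /\
  2 * sigma 2 G (a *: X + b *: G) =
    (a * S + n%:R * b) ^+ 2 - (a ^+ 2 * Q + 2 * a * b * S + n%:R * b ^+ 2).
Proof.
move=> uG a0 splitX S Q.
have /eigenvalues_split pe : char_poly ((a *: X + b *: G) *m invmx G) =
    \prod_(y <- [tuple of [seq a * x + b | x <- s]]) ('X - y%:P).
  rewrite mulmxDl -!scalemxAl mulmxV // scalemx1.
  by apply: char_poly_affine => //; rewrite size_tuple.
have sum1 : \sum_(x <- eigenvalues G (a *: X + b *: G)) x = a * S + n%:R * b.
  rewrite (perm_big _ pe) /= big_map big_split /= -mulr_sumr; congr (_ + _).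
  by rewrite big_tuple sumr_const card_ord mulr_natl.
rewrite /sigma elem_sym1 elem_sym2 sum1; split=> //; congr (_ - _).
rewrite (perm_big _ pe) /= big_map /S /Q.
transitivity (\sum_(x <- s) (a ^+ 2 * x ^+ 2 + 2 * a * b * x + b ^+ 2)).
  by apply: eq_bigr => x _; ring.
rewrite !big_split /= -!mulr_sumr; congr (_ + _).
by rewrite big_tuple sumr_const card_ord mulrnAr mulr_natl expr2.
Qed.

(** The default zero tuple has [sigma 1] equal to zero, so positivity yields a genuine splitting,
    carried back to [X] by the inverse affine map. *)
Lemma split_of_sigma1_affine_gt0 G X (a b : R) : G \in unitmx -> a != 0 ->
  0 < sigma 1 G (a *: X + b *: G) ->
  exists s, char_poly (X *m invmx G) = \prod_(x <- s) ('X - x%:P).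
Proof.
move=> uG a0; rewrite /sigma /eigenvalues.
case: xgetP => [t _ /= splitT _|_]; last first.
  by rewrite elem_sym1 big_tuple big1 ?ltxx // => i _; rewrite tnth_nseq.
exists [tuple of [seq a^-1 * x + (- (a^-1 * b)) | x <- t]].
have -> : X *m invmx G =
    a^-1 *: ((a *: X + b *: G) *m invmx G) + (- (a^-1 * b))%:M.
  rewrite mulmxDl -!scalemxAl mulmxV // scalerDr !scalerA mulVf // scale1r.
  by rewrite scalemx1 raddfN /= addrK.
by apply: char_poly_affine; rewrite ?invr_eq0 ?size_tuple.
Qed.

End Eigenvalues.

Lemma gamma2_schouten_ein (R : realType) (n : nat) (G X : 'M[R]_n) :
  G \in unitmx -> (4 <= n)%N ->
  let S := \tr (X *m invmx G) in
  let k : R := 2 * n%:R * (n%:R - 1) / (3 * n%:R - 4) in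
  let A := (n%:R - 2)^-1 *: (X - (S / (2 * (n%:R - 1))) *: G) in
  let E := S *: G - k *: X in
  (0 < sigma 1 G A /\ 0 < sigma 2 G A) <-> (0 < sigma 1 G E /\ 0 < sigma 2 G E).
Proof.
move=> uG hn S k A E.
have n4 : 4 <= n%:R :> R by rewrite (ler_nat _ 4).
have n0 : n%:R != 0 :> R by apply: lt0r_neq0; lra.
have n1 : n%:R - 1 != 0 :> R by apply: lt0r_neq0; lra.
have n2 : n%:R - 2 != 0 :> R by apply: lt0r_neq0; lra.
have n34 : 3 * n%:R - 4 != 0 :> R by apply: lt0r_neq0; lra.
have k0 : k != 0 by rewrite /k !mulf_neq0 ?invr_eq0 // pnatr_eq0.
pose b := - (n%:R - 2)^-1 * (S / (2 * (n%:R - 1))).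
have -> : A = (n%:R - 2)^-1 *: X + b *: G.
  by rewrite /A /b scalerBr scalerA -scaleNr mulNr.
have -> : E = - k *: X + S *: G.
  by rewrite /E scaleNr addrC.
have a0 : (n%:R - 2 : R)^-1 != 0 by rewrite invr_eq0.
have k0' : - k != 0 by rewrite oppr_eq0.
have [[s splitX]|nosplit] := pselect (exists s : n.-tuple R,
    char_poly (X *m invmx G) = \prod_(x <- s) ('X - x%:P)); last first.
  by split=> -[pos _]; case: nosplit;
    apply: split_of_sigma1_affine_gt0 pos.
have SE : S = \sum_(x <- s) x.
  by apply: trace_split; rewrite ?size_tuple // (leq_trans _ hn).
have [-> A2] := sigma_affine _ _ _ _ b uG a0 splitX.
have [-> E2] := sigma_affine _ _ _ _ S uG k0' splitX.
rewrite -SE in A2 E2 *; set Q := \sum_(x <- s) x ^+ 2 in A2 E2.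
(* [D] is the common factor of both [sigma 2]: the given [k] solves
   [1 - 2(n-1)/k + n(n-1)/k^2 = n/(4(n-1))], which matches the coefficients of [S ^+ 2]. *)
pose D := n%:R * S ^+ 2 / (4 * (n%:R - 1)) - Q.
have A1 : (n%:R - 2)^-1 * S +
    n%:R * b = (2 * (n%:R - 1))^-1 * S.
  by rewrite /b; field; rewrite n1 n2.
(* Although [X] enters [E] with coefficient [- k], the factor [n - k] is positive, so [sigma 1]
   keeps the sign of [S]. *)
have E1 : - k * S + n%:R * S = n%:R * (n%:R - 2) / (3 * n%:R - 4) * S.
  by rewrite /k; field.
have {}A2 : sigma 2 G ((n%:R - 2)^-1 *: X + b *: G) =
    (2 * (n%:R - 2) ^+ 2)^-1 * D.
  apply: (@mulfI _ 2); first by rewrite pnatr_eq0.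
  by rewrite A2 /D /b; field; rewrite n1 n2.
have {}E2 : sigma 2 G (- k *: X + S *: G) = k ^+ 2 / 2 * D.
  apply: (@mulfI _ 2); first by rewrite pnatr_eq0.
  by rewrite E2 /D /k; field; rewrite n1 n34.
have a1 : 0 < (2 * (n%:R - 1))^-1 :> R by rewrite invr_gt0; lra.
have a2 : 0 < (2 * (n%:R - 2) ^+ 2)^-1 :> R.
  by rewrite invr_gt0 mulr_gt0 ?exprn_gt0 //; lra.
have e1 : 0 < n%:R * (n%:R - 2) / (3 * n%:R - 4) :> R.
  by rewrite divr_gt0 ?mulr_gt0; lra.
have e2 : 0 < k ^+ 2 / 2 by rewrite divr_gt0 // exprn_even_gt0.
by rewrite A1 E1 A2 E2 (pmulr_rgt0 S a1) (pmulr_rgt0 D a2)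
  (pmulr_rgt0 S e1) (pmulr_rgt0 D e2).
Qed.

(** A nonzero kernel vector would have length zero, against positive definiteness. *)
Lemma metric_unit (R : realType) (n : nat) (M : smooth_manifold R n)
    (g : riemannian_metric M) (c : chart R n M) (x : 'rV[R]_n) :
  atlas c -> chart_cod c x -> g c x \in unitmx.
Proof.
move=> ac cx; rewrite unitmxE unitfE; apply/negP => /det0P[v v0 vg].
by have := metric_posdef g ac cx v0; rewrite vg mul0mx mxE ltxx.
Qed.

(** The contraction and the trace differ by a transposition of the inverse metric, which is
    symmetric. *)
Lemma Scal_trace (R : realType) (n : nat) (M : smooth_manifold R n)
    (g : riemannian_metric M) (c : chart R n M) (x : 'rV[R]_n) :
  atlas c -> chart_cod c x -> Scal g c x = \tr (Ric g c x *m invmx (g c x)).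
Proof.
move=> ac cx; rewrite /Scal /scalar_local /mxtrace; apply: eq_bigr => i _.
rewrite mxE; apply: eq_bigr => j _; rewrite mulrC; congr (_ * _).
by rewrite -[in LHS](metric_symmetric g ac cx) -trmx_inv mxE.
Qed.

Theorem proposition2p14 (R : realType) (n : nat) (M : smooth_manifold R n)
    (g : riemannian_metric M) (hn : (4 <= n)%N) :
  let k : R := 2 * n%:R * (n%:R - 1) / (3 * n%:R - 4) in
  Gamma2_pos g (Schouten g) <-> Gamma2_pos g (Ein g k).
Proof.
move=> k.
have pointwise p c : atlas c -> chart_dom c p ->
    (0 < sigma 1 (g c (c p)) (Schouten g c (c p)) /\
     0 < sigma 2 (g c (c p)) (Schouten g c (c p))) <->
    (0 < sigma 1 (g c (c p)) (Ein g k c (c p)) /\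
     0 < sigma 2 (g c (c p)) (Ein g k c (c p))).
  move=> ac cp; have cx : chart_cod c (c p) by exists p.
  rewrite /Schouten /Ein (Scal_trace _ _ _ g _ _ ac cx).
  exact: gamma2_schouten_ein (metric_unit _ _ _ g _ _ ac cx) hn.
split=> h p c ac cp.
- exact: (proj1 (pointwise p c ac cp)) (h p c ac cp).
- exact: (proj2 (pointwise p c ac cp)) (h p c ac cp).
Qed.
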